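(* Let $F$ be the distribution function of a nonnegative real random variable with tail $\overline{F}=1-F$. If for some real $s$ the quantity $\overline{F}(x)e^{xs}$ tends to a positive constant $c$ as $x\to+\infty$, then for all integers $k\geq 2$, $$\lim_{x\to+\infty}\overline{F^{*k}}(x)e^{xs}=+\infty.$$
   Context: $F^{*k}$ denotes the $k$-fold convolution of $F$ with itself, i.e. the distribution function of the sum of $k$ independent random variables each with distribution $F$, and $\overline{F^{*k}}=1-F^{*k}$ its tail. *)

(* Defs.v *)
From HB Require Import structures.
From mathcomp Require Import all_boot all_order all_algebra.
From mathcomp Require Import all_classical all_reals all_analysis.
From mathcomp Require Import measurable_realfun.

Set Implicit Arguments.
Unset Strict Implicit.
Unset Printing Implicit Defensive.

Import Order.TTheory GRing.Theory Num.Theory.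
Import numFieldNormedType.Exports.

Local Open Scope classical_set_scope.
Local Open Scope ring_scope.
Local Open Scope ereal_scope.

Section convolution.
Context {R : realType}.
Implicit Types mu nu : probability R R.

Definition addp (p : R * R) : R := (p.1 + p.2)%R.

Lemma measurable_addp : measurable_fun [set: R * R] addp.
Proof.
by apply: measurable_funD; [exact: measurable_fst | exact: measurable_snd].
Qed.

HB.instance Definition _ := isMeasurableFun.Build _ _ _ _ addp measurable_addp.

(* The law of the sum of the two coordinates under the product law, i.e. of the
   sum of two independent random variables with laws mu and nu. *)
Definition convolution mu nu : probability R R := distribution (mu \x nu) addp.

(* The Dirac mass at 0 is the unit of convolution, so the powers 1, 2, ... are
   mu, mu * mu, etc. *)
Fixpoint convolution_pow mu (k : nat) : probability R R :=
  if k is k'.+1 then convolution mu (convolution_pow mu k') else \d_(0%R : R).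

End convolution.

(* F^{*k} for F = cdf X; it only depends on the law of X, hence on F. *)
Definition cdf_convolution_pow d (T : measurableType d) (R : realType)
    (P : probability T R) (X : {RV P >-> R}) (k : nat) (x : R) : \bar R :=
  convolution_pow (distribution P X) k `]-oo, x]%classic.

(* The n-th convolution power of mu is the law of the sum of n mutually
   independent random variables with law mu. The product rule over all n
   variables suffices for independence: taking A i = setT drops the i-th one. *)
Section sum_of_independent.
Context d (T : measurableType d) (R : realType) (P : probability T R).
Context (X : nat -> {RV P >-> R}) (mu : probability R R) (n : nat).
Context (X_mu : forall i A, measurable A -> distribution P (X i) A = mu A).
Context (X_indep : forall A : nat -> set R, (forall i, measurable (A i)) ->
  P (\bigcap_(i in `I_n) (X i @^-1` A i)) =
  \prod_(i < n) distribution P (X i) (A i)).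

Let S m t := (\sum_(i < m) X i t)%R.

Let mS m : measurable_fun setT (S m).
Proof. by apply: measurable_sum => i; exact: measurable_funP. Qed.

Let partial m (A : nat -> set R) (B : set R) : (m <= n)%N ->
  (forall i, measurable (A i)) -> measurable B ->
  P (S m @^-1` B `&` \bigcap_(i in [set i | (m <= i < n)%N]) (X i @^-1` A i)) =
  convolution_pow mu m B * \prod_(m <= i < n) mu (A i).
Proof.
elim: m A B => [|m IH] A B mn mA mB.
  rewrite big_mkord
    (eq_bigr (fun i : 'I_n => distribution P (X i) (A i))); last first.
    by move=> i _; rewrite X_mu.
  rewrite -X_indep// (_ : [set i | (0 <= i < n)%N] = `I_n)//.
  rewrite /= diracE (_ : S 0 = cst 0%R); last first.
    by apply/funext => t; rewrite /S big_ord0.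
  rewrite preimage_cst; case: ifP => _; first by rewrite setTI mul1e.
  by rewrite set0I measure0 mul0e.
pose E := \bigcap_(i in [set i | (m < i < n)%N]) (X i @^-1` A i).
have mE : measurable E.
  apply: bigcap_measurableType => i _; rewrite -[X in measurable X]setTI.
  exact: measurable_funP.
pose q := \prod_(m.+1 <= i < n) mu (A i).
have q0 : (0 <= q)%E by apply: prode_ge0 => i _.
have qfin : q \is a fin_num.
  by apply: prode_fin_num => i _; rewrite fin_num_measure.
have q0' : (0 <= fine q)%R by exact: fine_ge0.
pose XS t := (X m t, S m t).
have mXS : measurable_fun setT XS.
  by apply: measurable_fun_pair; [exact: measurable_funP | exact: mS].
pose XSm : {mfun T >-> (R * R)%type} := mfun_Sub (mem_set mXS).
have key (C : set (R * R)) : measurable C ->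
    ((mscale (NngNum q0') mu) \x convolution_pow mu m) C =
    pushforward (mrestr P mE) XSm C.
  apply: product_measure_unique => A' B' mA' mB'.
  pose A2 (i : nat) : set R := if i == m then A' else A i.
  have mA2 i : measurable (A2 i) by rewrite /A2; case: ifP.
  have := IH A2 B' (ltnW mn) mA2 mB'.
  have A2m : A2 m = A' by rewrite /A2 eqxx.
  rewrite big_ltn// A2m.
  rewrite (@eq_big_nat _ _ _ m.+1 n (fun i => mu (A2 i)) (fun i => mu (A i))); last first.
    by move=> i /andP[mi _]; rewrite /A2 gtn_eqF.
  rewrite -/q => IH'.
  have -> : mscale (NngNum q0') mu A' * convolution_pow mu m B' =
      convolution_pow mu m B' * (mu A' * q).
    by rewrite /mscale /= fineK// muleC (muleC q).
  rewrite -IH'; congr (P _); apply/seteqP; split => t; rewrite ?/pushforward ?/mrestr /=.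
    move=> [[XA SB] Et]; split; first exact: SB.
    move=> i mi; move: (mi) => /= /andP[mi1 iN].
    rewrite /A2; case: ifP => [/eqP -> //|/negbT im].
    by apply: Et => /=; rewrite iN andbT ltn_neqAle eq_sym im.
  move=> [SB At]; split.
    by split=> //; have := At m; rewrite A2m/= leqnn; apply.
  move=> i /= /andP[mi iN]; have := At i.
  by rewrite /= (ltnW mi) iN /A2 gtn_eqF//; apply.
have mC : measurable (@addp R @^-1` B).
  by rewrite -[X in measurable X]setTI; exact: measurable_addp.
have := key _ mC.
rewrite /product_measure1 ge0_integral_mscale//=; last first.
  exact: measurable_fun_xsection.
rewrite fineK// muleC => keyC.
transitivity (pushforward (mrestr P mE) XSm (@addp R @^-1` B)); last by rewrite -keyC.
rewrite /pushforward/mrestr; congr (P (_ `&` _)).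
by apply/seteqP; split => t /=; rewrite /S big_ord_recr/= /addp/= addrC.
Qed.

Lemma distribution_sum_independent (B : set R) : measurable B ->
  P [set t | B (\sum_(i < n) X i t)%R] = convolution_pow mu n B.
Proof.
move=> mB; have := partial (leqnn n) (fun=> measurableT) mB.
rewrite big_geq// mule1 => <-; congr (P _); apply/seteqP; split=> t /=.
  by move=> SB; split=> // i /= /andP[ni /(leq_ltn_trans ni)]; rewrite ltnn.
by case.
Qed.

End sum_of_independent.

(* Main.v *)
(** Write [G] for the tail of [mu], so that [e^{xs} G(x) >= a > 0] for [x >= M]. Since
[G -> 0], there are points [M = x_0 < x_1 < ...] with [mu ]x_i, x_{i+1}] >= (a/2) e^{-s x_i}].
If the tail of [nu] has the same lower bound, the disjoint events [x_i < X <= x_{i+1}],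
[Y > x - x_i] all lie in [X + Y > x], and once [x >= M + x_i] each has probability at least
[(a^2/2) e^{-sx}]. The number of such events grows without bound with [x]. For [mu] carried
by [[0, +oo[] the tails of the convolution powers increase with the exponent, so [nu] can be any
of them. *)
Require Import Defs.
From mathcomp Require Import all_boot all_order all_algebra.
From mathcomp Require Import all_classical all_reals all_analysis.
From mathcomp Require Import lra.

Import Order.TTheory GRing.Theory Num.Theory.
Import numFieldNormedType.Exports.

Local Open Scope classical_set_scope.
Local Open Scope ring_scope.
Local Open Scope ereal_scope.

(** The rectangles [A i]*[B i] inherit disjointness from the [A i], and their union lies in the
    preimage of [C] under addition. *)
Lemma convolution_ge_sum (R : realType) (mu nu : probability R R) (n : nat)
    (A B : nat -> set R) (C : set R) :
  (forall i, measurable (A i)) -> (forall i, measurable (B i)) -> measurable C ->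
  trivIset setT A -> (forall i x y, A i x -> B i y -> C (x + y)%R) ->
  \sum_(i < n) mu (A i) * nu (B i) <= convolution mu nu C.
Proof.
move=> mA mB mC tA ABC.
have mAB i : measurable (A i `*` B i) by exact: measurableX.
have tAB : trivIset setT (fun i => A i `*` B i).
  by move=> i j _ _ [[x y] [[Aix _] [Ajx _]]]; apply: (tA i j) => //; exists x.
under eq_bigr do rewrite -product_measure1E//.
have /(_ n) <- := measure_bigsetU (mu \x nu) mAB tAB.
apply: le_measure; rewrite ?inE.
- exact: bigsetU_measurable.
- by rewrite -[X in measurable X]setTI; exact: measurable_addp.
rewrite -(bigcup_mkord n (fun i => A i `*` B i)) => -[x y] [i _ [/= Aix Biy]].
exact: ABC Aix Biy.
Qed.

Lemma convolution_ge (R : realType) (mu nu : probability R R) (A B C : set R) :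
  measurable A -> measurable B -> measurable C ->
  (forall x y, A x -> B y -> C (x + y)%R) ->
  mu A * nu B <= convolution mu nu C.
Proof.
move=> mA mB mC ABC.
(* Padding with empty sets turns the single set [A] into a disjoint sequence. *)
pose A' i := if i == 0%N then A else set0.
have := @convolution_ge_sum R mu nu 1 A' (fun=> B) C.
rewrite big_ord1; apply => //.
- by move=> i; rewrite /A'; case: ifP.
- by apply: ltn_trivIset => -[|m] i // _; rewrite /A' /= (setI0, set0I).
- by rewrite /A' => -[|i] x y //=; exact: ABC.
Qed.

(** Adding an independent nonnegative variable can only enlarge a sum: the rectangle [[0, +oo[]
    times []x, +oo[], whose first side has mass 1, gives the induction step. *)
Lemma convolution_pow_tail_ge (R : realType) (mu : probability R R) (n : nat) (x : R) :
  mu `[0%R, +oo[%classic = 1 ->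
  mu `]x, +oo[%classic <= convolution_pow mu n.+1 `]x, +oo[%classic.
Proof.
move=> mu0; elim: n => [|n IH].
  (* The first power is [mu] convolved with the Dirac mass at 0, so the second side of the rectangle
     is [{0}]. *)
  have := @convolution_ge R mu (\d_(0%R : R))
    `]x, +oo[%classic [set 0%R] `]x, +oo[%classic.
  rewrite /= diracE mem_set// mule1; apply => // y z /=.
  by move=> + ->; rewrite addr0.
apply: (le_trans IH).
have := @convolution_ge R mu (convolution_pow mu n.+1)
  `[0%R, +oo[%classic `]x, +oo[%classic `]x, +oo[%classic.
rewrite mu0 mul1e; apply => // y z /=.
by rewrite !in_itv/= !andbT; lra.
Qed.

Lemma cvg_tail0 (R : realType) (mu : probability R R) :
  mu `]x, +oo[%classic @[x --> +oo%R] --> 0.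
Proof.
have mid : measurable_fun [set: R] (@idfun R) by exact: measurable_id.
(* The identity is a random variable of law [mu], whose [ccdf] is the tail in question. *)
pose Y : {RV mu >-> R} := mfun_Sub (mem_set mid).
exact: cvg_ccdfy0 Y.
Qed.

Lemma convolution_tail_cvgy (R : realType) (mu nu : probability R R) (s a M : R) :
  (0 < a)%R ->
  (forall x, (M <= x)%R -> (a * expR (- (x * s)))%:E <= mu `]x, +oo[%classic) ->
  (forall x, (M <= x)%R -> (a * expR (- (x * s)))%:E <= nu `]x, +oo[%classic) ->
  convolution mu nu `]x, +oo[%classic * (expR (x * s))%:E @[x --> +oo%R] --> +oo.
Proof.
move=> a0 mu_ge nu_ge.
(* Beyond [x], the tail eventually falls below half of the lower bound known at [x]; the other half
   is then left on []x, z]]. *)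
have next x : exists z, (x < z)%R /\
    mu `]z, +oo[%classic <= (a / 2 * expR (- (x * s)))%:E.
  have e0 : (0 < a / 2 * expR (- (x * s)))%R by rewrite mulr_gt0 ?expR_gt0//; lra.
  have /fine_cvgP[_ /cvgr_lt/(_ _ e0) mu_lt] := @cvg_tail0 R mu.
  have : \forall z \near +oo%R, (x < z)%R /\ (fine (mu `]z, +oo[%classic) <
      a / 2 * expR (- (x * s)))%R.
    by apply: filterI; [exact: nbhs_pinfty_gt (num_real x) | exact: mu_lt].
  move=> /filter_ex[z [xz muz]]; exists z; split => //.
  by rewrite -[leLHS]fineK ?fin_num_measure// lee_fin ltW.
have [f f_next] := choice next.
pose xs i := iter i f M.
have xs_lt i : (xs i < xs i.+1)%R by exact: (f_next _).1.
have xs_le : {homo xs : i j / (i <= j)%N >-> (i <= j)%R}.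
  by apply/nondecreasing_seqP => i; exact: ltW.
have M_xs i : (M <= xs i)%R by exact: (xs_le 0%N).
pose A i := [set` `]xs i, xs i.+1]].
have tA : trivIset setT A.
  apply: ltn_trivIset => j i ij; apply/seteqP; split => // x []; rewrite /A /=.
  rewrite !in_itv/= => /andP[_ xi] /andP[xj _].
  by have := lt_le_trans xj (le_trans xi (xs_le _ _ ij)); rewrite ltxx.
have muA i : (a / 2 * expR (- (xs i * s)))%:E <= mu (A i).
  have -> : A i = `]xs i, +oo[%classic `\` `]xs i.+1, +oo[%classic.
    apply/seteqP; split => y; rewrite /A /= !in_itv/= !andbT.
      by move=> /andP[-> yi]; split => //; rewrite ltNge yi.
    by move=> [-> /negP]; rewrite -leNgt.
  rewrite measureD//; last by rewrite ltey_eq fin_num_measure.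
  rewrite setIidr; last first.
    by move=> y /=; rewrite !in_itv/= !andbT; exact/lt_trans.
  rewrite leeBrDr ?fin_num_measure//.
  apply: le_trans (mu_ge _ (M_xs i)).
  apply: le_trans (leeD2l _ (f_next (xs i)).2) _.
  by rewrite -EFinD lee_fin; lra.
apply/cvgeyPge => K.
(* After multiplication by [expR (x * s)], each rectangle contributes at least [a * a / 2]. The
   number [n] depends on [K] only, so [x] can be taken large afterwards. *)
have [n Kn] : exists n, (K <= n%:R * (a * a / 2))%R.
  have aa : (0 < a * a / 2)%R by rewrite divr_gt0 ?mulr_gt0.
  exists (Num.truncn (K / (a * a / 2))).+1.
  by rewrite -ler_pdivrMr// ltW// truncnS_gt.
near=> x.
(* This keeps [x - xs i] above [M] for all [i < n], as [nu_ge] requires. *)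
have x_ge : (M + xs n <= x)%R by near: x; apply: nbhs_pinfty_ge; rewrite num_real.
apply: (@le_trans _ _ ((n%:R * (a * a / 2) * expR (- (x * s)))%:E * (expR (x * s))%:E)).
  by rewrite -EFinM lee_fin -(mulrA _ (expR _)) -expRD addNr expR0 mulr1.
apply: lee_wpmul2r; first by rewrite lee_fin expR_ge0.
pose B i : set R := [set` `](x - xs i)%R, +oo[].
have mA i : measurable (A i) by exact: measurable_itv.
have mB i : measurable (B i) by exact: measurable_itv.
have AB i y z : A i y -> B i z -> `]x, +oo[%classic (y + z)%R.
  by rewrite /A /B /= !in_itv/= !andbT => /andP[+ _]; lra.
apply: le_trans (@convolution_ge_sum R mu nu n A B _ mA mB _ tA AB) => //.
apply: (@le_trans _ _ (\sum_(i < n) (a * a / 2 * expR (- (x * s)))%:E)).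
  by rewrite sumEFin lee_fin sumr_const card_ord -[leRHS]mulr_natl -(mulrA n%:R).
apply: lee_sum => i _.
(* The [xs i] cancel in the exponents, so the bound is the same for every [i]. *)
have -> : (a * a / 2 * expR (- (x * s)) =
    (a / 2 * expR (- (xs i * s))) * (a * expR (- ((x - xs i) * s))))%R.
  rewrite mulrACA -expRD; congr (_ * expR _)%R; lra.
rewrite EFinM; apply: lee_pmul => //.
- by rewrite lee_fin mulr_ge0 ?expR_ge0//; lra.
- by rewrite lee_fin mulr_ge0 ?expR_ge0//; lra.
apply: nu_ge; have := xs_le _ _ (ltnW (ltn_ord i)); lra.
Unshelve. all: by end_near.
Qed.

Theorem proposition6 (R : realType) (d : measure_display)
    (T : measurableType d) (P : probability T R) (X : {RV P >-> R})
    (X_ge0 : forall t : T, (0 <= X t)%R) (s c : R) (c_gt0 : (0 < c)%R)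
    (tail_X : (1 - cdf X x) * (expR (x * s))%:E @[x --> +oo%R] --> c%:E) :
  forall k : nat, (2 <= k)%N ->
    (1 - cdf_convolution_pow X k x) * (expR (x * s))%:E @[x --> +oo%R] --> +oo.
Proof.
move=> [|[|k]] // _.
pose mu := distribution P X.
have mu0 : mu `[0%R, +oo[%classic = 1.
  rewrite -(probability_setT P); congr (P _).
  by apply/seteqP; split => t //= _; rewrite in_itv/= X_ge0.
have tailE n x : 1 - cdf_convolution_pow X n x = convolution_pow mu n `]x, +oo[%classic.
  by rewrite /cdf_convolution_pow -probability_setC// setCitvl.
have [M mu_ge] : exists M, forall x, (M <= x)%R ->
    (c / 2 * expR (- (x * s)))%:E <= mu `]x, +oo[%classic.
  have c2 : (c / 2 < c)%R by lra.
  have /fine_cvgP[_ /cvgr_gt/(_ _ c2)[M [_ tail_gt]]] := tail_X.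
  (* The neighbourhood of [+oo] gives the bound for [M < x] only; the shift by 1 allows a large
     inequality. *)
  exists (M + 1)%R => x Mx.
  have /tail_gt/= : (M < x)%R by lra.
  rewrite -ccdf_1_cdf -[ccdf X x]fineK ?fin_num_measure// -EFinM/= => lt_tail.
  rewrite -[leRHS]fineK ?fin_num_measure// lee_fin expRN.
  by rewrite ler_pdivrMr ?expR_gt0// ltW.
under eq_fun do rewrite tailE.
(* The exponent is now [k.+2], and this power unfolds to [mu] convolved with the power [k.+1]. *)
apply: (@convolution_tail_cvgy R mu (convolution_pow mu k.+1) s (c / 2) M) => //.
  lra.
by move=> x /mu_ge /le_trans; apply; exact: convolution_pow_tail_ge.
Qed.
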